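(* Let $X$ be a complex Banach space, $\tau>0$, $T=(N+1)\tau$ for a fixed $N\in\mathbb{N}_{0}$, and let $A_{0},A_{1}\in\mathcal{L}(X)$ have non-zero commutator $[A_{0},A_{1}]:=A_{0}A_{1}-A_{1}A_{0}\ne 0$. Then the fundamental solution $\mathcal{S}(\cdot;\tau):[-\tau,T]\to\mathcal{L}(X)$ of $\frac{\mathrm{d}}{\mathrm{d}t}u(t)=A_{0}u(t)+A_{1}u(t-\tau)$, satisfying $\mathcal{S}(t;\tau)=\Theta$ for $-\tau\le t<0$ and $\mathcal{S}(0;\tau)=I$, can be represented, for every $n\in\{0,1,\dots,N\}$, by $$\mathcal{S}(t;\tau)=\sum_{l=0}^{n}\sum_{k=l}^{\infty}\mathcal{Q}_{k+1}(l\tau)\frac{(t-l\tau)^{k}}{k!},\quad n\tau<t\le (n+1)\tau,$$ where the family $\{\mathcal{Q}_{k+1}(l\tau):k,l\in\mathbb{N}_{0}\}\subset\mathcal{L}(X)$ is given by $$\mathcal{Q}_{k+1}(0):=A_{0}^{k},\ k\in\mathbb{N}_{0},\qquad \mathcal{Q}_{k+1}(l\tau):=\sum_{m=l}^{k}A_{0}^{k-m}A_{1}\mathcal{Q}_{m}((l-1)\tau),\ k,l\in\mathbb{N}.$$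
   Context: $\mathbb{N}_0=\mathbb{N}\cup\{0\}$; $I$ and $\Theta$ are the identity and zero operators. Empty sums are $\Theta$, and $\mathcal{Q}_{1}(l\tau)=\Theta$ for $l\ge 1$. Here $\mathcal{T}(t)=\exp(A_{0}t)=\sum_{k\ge 0}A_{0}^{k}t^{k}/k!$. The fundamental solution is the operator family satisfying $\frac{\mathrm{d}}{\mathrm{d}t}\mathcal{S}(t;\tau)=A_{0}\mathcal{S}(t;\tau)+A_{1}\mathcal{S}(t-\tau;\tau)$ for $t\ge 0$ with the stated initial conditions; it is given explicitly by $\mathcal{S}(t;\tau)=\sum_{l=0}^{n}S_{l}(t,l\tau)$ for $n\tau<t\le(n+1)\tau$, where $S_{0}(t,0)=\exp(A_{0}t)$ and $S_{l}(t,l\tau)=\int_{l\tau}^{t}\exp(A_{0}(t-s))A_{1}S_{l-1}(s-\tau,(l-1)\tau)\,\mathrm{d}s$ for $t\ge l\tau$, $l\in\mathbb{N}$. *)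

(* Defs.v *)
From Stdlib Require Import Reals Lra Lia.
From Stdlib Require Import FunctionalExtensionality ProofIrrelevance.
From Coquelicot Require Import Coquelicot.
Open Scope R_scope.

(* Coquelicot's [is_linear] includes the bound ||f x|| <= M ||x||, so this is
   the space L(X) of bounded C-linear operators. *)
Record bdop (X : NormedModule C_AbsRing) : Type := Bdop {
  bdop_fun :> X -> X;
  bdop_linear : is_linear bdop_fun
}.
Arguments Bdop {X}.
Arguments bdop_fun {X}.
Arguments bdop_linear {X}.

Section BoundedOperators.

Context {X : NormedModule C_AbsRing}.
Implicit Types f g h : bdop X.

Lemma bdop_ext f g : (forall x, f x = g x) -> f = g.
Proof.
destruct f as [f Hf], g as [g Hg]; simpl; intros E.
assert (f = g) by (apply functional_extensionality; exact E); subst g.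
now rewrite (proof_irrelevance _ Hf Hg).
Qed.

Lemma is_linear_add f g : is_linear (fun x : X => plus (f x) (g x)).
Proof.
exact (is_linear_comp (fun x => (f x, g x)) (fun p => plus (fst p) (snd p))
  (is_linear_prod _ _ (bdop_linear f) (bdop_linear g)) is_linear_plus).
Qed.

Lemma is_linear_rscal (r : R) f : is_linear (fun x : X => scal (K := C_AbsRing) (RtoC r) (f x)).
Proof.
apply (is_linear_comp f (fun x : X => scal (K := C_AbsRing) (RtoC r) x)).
- apply bdop_linear.
- apply is_linear_scal_r. intros; apply Cmult_comm.
Qed.

Definition bdop_plus f g : bdop X := Bdop _ (is_linear_add f g).
Definition bdop_opp f : bdop X := Bdop _ (is_linear_comp f opp (bdop_linear f) is_linear_opp).
Definition bdop_zero : bdop X := Bdop _ is_linear_zero.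
Definition bdop_one : bdop X := Bdop _ is_linear_id.
Definition bdop_mult f g : bdop X :=
  Bdop (fun x => f (g x)) (is_linear_comp g f (bdop_linear g) (bdop_linear f)).
Definition bdop_scal (r : R) f : bdop X := Bdop _ (is_linear_rscal r f).

Definition bdop_norm f : R :=
  real (Lub_Rbar (fun y => exists x : X, norm x <= 1 /\ y = norm (f x))).

Lemma bdop_norm_aux f :
  is_lub_Rbar (fun y => exists x : X, norm x <= 1 /\ y = norm (f x)) (bdop_norm f).
Proof.
destruct (linear_norm _ (bdop_linear f)) as [M [HM Hf]].
unfold bdop_norm.
assert (H := Lub_Rbar_correct (fun y => exists x : X, norm x <= 1 /\ y = norm (f x))).
destruct (Lub_Rbar _) as [l| |]; simpl; [exact H| |]; exfalso; destruct H as [H1 H2].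
- refine (H2 M _). intros y [x [Hx ->]]. simpl. specialize (Hf x). nra.
- refine (H1 0 _). exists zero. split.
  + rewrite norm_zero. lra.
  + now rewrite (linear_zero _ (bdop_linear f)), norm_zero.
Qed.

Lemma bdop_norm_pos f : 0 <= bdop_norm f.
Proof.
apply (proj1 (bdop_norm_aux f) 0). exists zero. split.
- rewrite norm_zero. lra.
- now rewrite (linear_zero _ (bdop_linear f)), norm_zero.
Qed.

Lemma bdop_norm_bound f (x : X) : norm (f x) <= bdop_norm f * norm x.
Proof.
destruct (Req_dec (norm x) 0) as [E|E].
- apply norm_eq_zero in E. subst x.
  rewrite (linear_zero _ (bdop_linear f)), norm_zero. lra.
- assert (Hp : 0 < norm x) by (generalize (norm_ge_0 x); lra).
  set (r := / norm x).
  assert (Hr : 0 < r) by (apply Rinv_0_lt_compat; exact Hp).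
  assert (Hrx : r * norm x = 1) by (unfold r; field; lra).
  assert (A : forall s : R, 0 <= s -> abs (RtoC s : C_AbsRing) = s).
  { intros s Hs. change (Cmod (RtoC s) = s). rewrite Cmod_R. now apply Rabs_pos_eq. }
  assert (H : norm (f (scal (RtoC r : C_AbsRing) x)) <= bdop_norm f).
  { apply (proj1 (bdop_norm_aux f) (norm (f (scal (RtoC r : C_AbsRing) x)))).
    eexists; split; [|reflexivity].
    eapply Rle_trans; [apply @norm_scal|]. rewrite A; lra. }
  assert (E2 : x = scal (RtoC (norm x) : C_AbsRing) (scal (RtoC r : C_AbsRing) x)).
  { rewrite scal_assoc. change (@mult C_AbsRing) with Cmult.
    rewrite <- RtoC_mult, (Rmult_comm (norm x)), Hrx. symmetry.
    apply (scal_one (K := C_AbsRing) (V := NormedModule.ModuleSpace C_AbsRing X)). }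
  rewrite E2 at 1. rewrite (linear_scal _ (bdop_linear f)).
  eapply Rle_trans; [apply @norm_scal|]. rewrite A by lra. nra.
Qed.

Lemma bdop_norm_le f (M : R) :
  0 <= M -> (forall x : X, norm (f x) <= M * norm x) -> bdop_norm f <= M.
Proof.
intros HM H. apply (proj2 (bdop_norm_aux f) M).
intros y [x [Hx ->]]. simpl. specialize (H x). nra.
Qed.

Definition bdop_AbelianMonoid_mixin : AbelianMonoid.mixin_of (bdop X).
Proof.
apply (AbelianMonoid.Mixin _ bdop_plus bdop_zero);
  intros; apply bdop_ext; intro; simpl.
- apply plus_comm.
- apply plus_assoc.
- apply plus_zero_r.
Defined.
Canonical bdop_AbelianMonoid : AbelianMonoid :=
  AbelianMonoid.Pack (bdop X) bdop_AbelianMonoid_mixin (bdop X).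

Definition bdop_AbelianGroup_mixin : AbelianGroup.mixin_of bdop_AbelianMonoid.
Proof.
apply (AbelianGroup.Mixin _ bdop_opp).
intros; apply bdop_ext; intro x0; simpl. exact (plus_opp_r (x x0)).
Defined.
Canonical bdop_AbelianGroup : AbelianGroup :=
  AbelianGroup.Pack (bdop X) (AbelianGroup.Class _ _ bdop_AbelianGroup_mixin) (bdop X).

Definition bdop_Ring_mixin : Ring.mixin_of bdop_AbelianGroup.
Proof.
apply (Ring.Mixin _ bdop_mult bdop_one);
  intros; apply bdop_ext; intro; simpl; try reflexivity.
apply linear_plus, bdop_linear.
Defined.
Canonical bdop_Ring : Ring :=
  Ring.Pack (bdop X) (Ring.Class _ _ bdop_Ring_mixin) (bdop X).

(* Scalars are restricted to R because the independent variable t is real. *)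
Definition bdop_ModuleSpace_mixin : ModuleSpace.mixin_of R_Ring bdop_AbelianGroup.
Proof.
apply (ModuleSpace.Mixin R_Ring bdop_AbelianGroup bdop_scal);
  intros; apply bdop_ext; intro; simpl.
- rewrite scal_assoc. f_equal. change (@mult C_AbsRing) with Cmult.
  symmetry; apply RtoC_mult.
- apply (scal_one (K := C_AbsRing) (V := NormedModule.ModuleSpace C_AbsRing X)).
- apply (scal_distr_l (K := C_AbsRing) (V := NormedModule.ModuleSpace C_AbsRing X)).
- change (RtoC (plus x y)) with (RtoC (x + y)). rewrite RtoC_plus.
  apply (scal_distr_r (K := C_AbsRing) (V := NormedModule.ModuleSpace C_AbsRing X)).
Defined.
Canonical bdop_ModuleSpace : ModuleSpace R_Ring :=
  ModuleSpace.Pack R_Ring (bdop X)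
    (ModuleSpace.Class R_Ring _ _ bdop_ModuleSpace_mixin) (bdop X).

Lemma bdop_norm_triangle f g : bdop_norm (plus f g) <= bdop_norm f + bdop_norm g.
Proof.
generalize (bdop_norm_pos f) (bdop_norm_pos g); intros Hf Hg.
apply bdop_norm_le; [lra|]. intro x. simpl.
eapply Rle_trans; [apply @norm_triangle|].
generalize (bdop_norm_bound f x) (bdop_norm_bound g x). lra.
Qed.

Lemma bdop_norm_scal (r : R) f : bdop_norm (scal r f) <= Rabs r * bdop_norm f.
Proof.
generalize (bdop_norm_pos f) (Rabs_pos r); intros Hf Hr.
apply bdop_norm_le; [nra|]. intro x. simpl.
eapply Rle_trans; [apply @norm_scal|].
change (abs (RtoC r : C_AbsRing)) with (Cmod (RtoC r)). rewrite Cmod_R.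
generalize (bdop_norm_bound f x). nra.
Qed.

Lemma bdop_norm_eq_zero f : bdop_norm f = 0 -> f = zero.
Proof.
intros H. apply bdop_ext. intro x. apply norm_eq_zero.
generalize (bdop_norm_bound f x) (norm_ge_0 (f x)). rewrite H. lra.
Qed.

Lemma bdop_norm_zero : bdop_norm zero = 0.
Proof.
apply Rle_antisym; [|apply bdop_norm_pos].
apply bdop_norm_le; [lra|]. intro x. simpl. rewrite norm_zero. lra.
Qed.

Lemma bdop_norm_opp f : bdop_norm (opp f) = bdop_norm f.
Proof.
assert (H : forall f, bdop_norm (opp f) <= bdop_norm f).
{ intro g. apply bdop_norm_le; [apply bdop_norm_pos|]. intro x. simpl.
  rewrite norm_opp. apply bdop_norm_bound. }
apply Rle_antisym; [apply H|]. rewrite <- (opp_opp f) at 1. apply H.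
Qed.

Lemma bdop_norm_mult f g : bdop_norm (mult f g) <= bdop_norm f * bdop_norm g.
Proof.
generalize (bdop_norm_pos f) (bdop_norm_pos g); intros Hf Hg.
apply bdop_norm_le; [nra|]. intro x. simpl.
eapply Rle_trans; [apply bdop_norm_bound|].
generalize (bdop_norm_bound g x). nra.
Qed.

Definition bdop_ball f (e : R) g : Prop := bdop_norm (minus g f) < e.

Definition bdop_UniformSpace_mixin : UniformSpace.mixin_of (bdop X).
Proof.
apply (UniformSpace.Mixin _ zero bdop_ball).
- intros f e. unfold bdop_ball. rewrite (minus_eq_zero (G := bdop_AbelianGroup)).
  change (bdop_norm (zero : bdop X) < e). rewrite bdop_norm_zero. apply cond_pos.
- intros f g e. unfold bdop_ball. rewrite <- opp_minus.
  now rewrite (bdop_norm_opp (minus f g)).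
- intros f g h e1 e2. unfold bdop_ball. intros H1 H2.
  rewrite (minus_trans g).
  eapply Rle_lt_trans; [apply bdop_norm_triangle|]. lra.
Defined.
Canonical bdop_UniformSpace : UniformSpace :=
  UniformSpace.Pack (bdop X) bdop_UniformSpace_mixin (bdop X).

Canonical bdop_NormedModuleAux : NormedModuleAux R_AbsRing :=
  NormedModuleAux.Pack R_AbsRing (bdop X)
    (NormedModuleAux.Class R_AbsRing _ (ModuleSpace.class R_Ring bdop_ModuleSpace)
       bdop_UniformSpace_mixin) (bdop X).

Definition bdop_NormedModule_mixin : NormedModule.mixin_of R_AbsRing bdop_NormedModuleAux.
Proof.
apply (NormedModule.Mixin R_AbsRing bdop_NormedModuleAux bdop_norm 1).
- exact bdop_norm_triangle.
- exact bdop_norm_scal.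
- intros f g e H. exact H.
- intros f g e H. rewrite Rmult_1_l. exact H.
- exact bdop_norm_eq_zero.
Defined.
Canonical bdop_NormedModule : NormedModule R_AbsRing :=
  NormedModule.Pack R_AbsRing (bdop X)
    (NormedModule.Class R_AbsRing _ _ bdop_NormedModule_mixin) (bdop X).

End BoundedOperators.

(* [Qop A0 A1 j l] stands for Q_j(l tau). The index j = 0 is never used; the case
   j = 1, l >= 1 is an empty sum, hence zero. *)
Fixpoint Qop {X : NormedModule C_AbsRing} (A0 A1 : bdop X) (j l : nat) {struct l} : bdop X :=
  match j with
  | O => zero
  | S k =>
      match l with
      | O => pow_n A0 k
      | S l' =>
          sum_n_m (fun m => mult (mult (pow_n A0 (k - m)) A1) (Qop A0 A1 m l')) l k
      end
  end.

(* The right-hand side A0 S(t) + A1 S(t - tau) jumps by A1 at t = tau, because S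
   jumps from zero to the identity at 0. The equation is therefore imposed with
   the derivative relative to [0, T] (one-sided at 0 and T), except at t = tau,
   where only the derivative from the right can satisfy it; S itself is
   continuous on [0, T] in operator norm. *)
Record is_fundamental_solution {X : NormedModule C_AbsRing}
    (A0 A1 : bdop X) (tau T : R) (Sol : R -> bdop X) : Prop := {
  fs_history : forall t, - tau <= t < 0 -> Sol t = zero;
  fs_init : Sol 0 = one;
  fs_continuous : forall t, 0 <= t <= T ->
    filterlim Sol (within (fun s => 0 <= s <= T) (locally t)) (locally (Sol t));
  fs_equation : forall t, 0 <= t <= T ->
    filterdiff Sol
      (within (fun s => 0 <= s <= T /\ (t = tau -> tau <= s)) (locally t))
      (fun h : R => scal h (plus (mult A0 (Sol t)) (mult A1 (Sol (t - tau)))))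
}.

(* Main.v *)
(* The power series V_l(s) = sum_k Q_{k+1}(l tau) s^k / k! converge in L(X) because
   ||Q_{k+1}(l tau)|| <= (||A0|| + ||A1||)^k. The recurrence
   Q_{k+2}(l tau) = A0 Q_{k+1}(l tau) + A1 Q_{k+1}((l-1) tau) says that
   V_l' = A0 V_l + A1 V_{l-1}, with V_0(0) = I and V_l(0) = 0 for l >= 1. Hence the
   sum over l of V_l(t - l tau), each V_l being cut off to zero for negative
   arguments, solves the delay equation. A solution is unique: the difference D of
   two solutions has a right derivative bounded by (||A0|| + ||A1||) times the
   running maximum of ||D||, and a Gronwall argument gives D = 0. *)

Require Import Defs.
From Stdlib Require Import Reals Factorial Lra Lia ClassicalEpsilon.
From Coquelicot Require Import Coquelicot.
Open Scope R_scope.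

(** * Series in normed modules *)

Section Series.

Context {K : AbsRing} {V : NormedModule K}.

Lemma is_series_eq (a : nat -> V) (l1 l2 : V) :
  is_series a l1 -> is_series a l2 -> l1 = l2.
Proof. exact (filterlim_locally_unique (sum_n a) l1 l2). Qed.

Lemma norm_is_series_le (a : nat -> V) (b : nat -> R) (l : V) (B : R) :
  (forall k, norm (a k) <= b k) -> is_series a l -> is_series b B -> norm l <= B.
Proof.
intros Hab Ha Hb.
apply (filterlim_le (F := eventually) (fun n => norm (sum_n a n)) (sum_n b)
         (Finite (norm l)) (Finite B)).
- exists 0%nat. intros n _.
  eapply Rle_trans; [apply norm_sum_n_m|]. apply sum_n_m_le, Hab.
- exact (filterlim_comp _ _ _ _ _ _ _ _ Ha (filterlim_norm l)).
- exact Hb.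
Qed.

End Series.

Lemma is_series_linear {K : AbsRing} {U V : NormedModule K} (f : U -> V)
    (a : nat -> U) (l : U) :
  is_linear f -> is_series a l -> is_series (fun k => f (a k)) (f l).
Proof.
intros Hf Ha. unfold is_series.
apply filterlim_ext with (fun n => f (sum_n a n)).
- induction x as [|n IH]; [now rewrite !sum_O|].
  now rewrite !sum_Sn, linear_plus, IH.
- exact (filterlim_comp _ _ _ _ _ _ _ _ Ha (linear_cont f l Hf)).
Qed.

(** * Operator algebra and convergence of operator series *)

Section OperatorSeries.

Context {X : NormedModule C_AbsRing}.
Implicit Types f g h : bdop X.

Lemma is_linear_mult_l f : is_linear (fun g : bdop X => mult f g).
Proof.
split.
- exact (mult_distr_l (K := bdop_Ring) f).
- intros r g. apply bdop_ext. intro x. simpl. apply (linear_scal _ (bdop_linear f)).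
(* The constant in [is_linear] must be strictly positive, hence the [+ 1]. *)
- exists (bdop_norm f + 1). split; [generalize (bdop_norm_pos f); lra|].
  intro g. eapply Rle_trans; [apply bdop_norm_mult|].
  change (norm g) with (bdop_norm g).
  generalize (bdop_norm_pos f) (bdop_norm_pos g). nra.
Qed.

Lemma bdop_mult_zero_r f : mult f (zero : bdop X) = (zero : bdop X).
Proof. exact (mult_zero_r (K := bdop_Ring) f). Qed.

Lemma norm_bdop_zero : norm (zero : bdop X) = 0.
Proof. exact bdop_norm_zero. Qed.

Lemma bdop_scal_zero_r (r : R) : scal r (zero : bdop X) = (zero : bdop X).
Proof. exact (scal_zero_r (V := bdop_ModuleSpace) r). Qed.

Lemma bdop_minus_zero_r f : minus f (zero : bdop X) = f.
Proof. exact (minus_zero_r (G := bdop_AbelianGroup) f). Qed.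

Lemma bdop_mult_sum_n f (u : nat -> bdop X) n :
  mult f (sum_n u n) = sum_n (fun k => mult f (u k) : bdop X) n.
Proof. symmetry. exact (sum_n_m_mult_l (K := bdop_Ring) f u 0 n). Qed.

Lemma bdop_mult_minus f g h : mult f (minus g h) = minus (mult f g : bdop X) (mult f h).
Proof.
apply bdop_ext. intro x. simpl.
now rewrite (linear_plus _ (bdop_linear f)), (linear_opp _ _ (bdop_linear f)).
Qed.

Lemma norm_bdop_one : norm (one : bdop X) <= 1.
Proof. apply bdop_norm_le; [lra|]. intro x. simpl. lra. Qed.

Lemma sum_n_bdop (c : nat -> bdop X) (x : X) n :
  sum_n c n x = sum_n (fun k => c k x) n.
Proof.
induction n as [|n IH]; [now rewrite !sum_O|].
now rewrite !sum_Sn, <- IH.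
Qed.

End OperatorSeries.

(** Completeness of [X] gives the sums pointwise; uniqueness of limits makes the limit map linear,
    and the majorant makes it bounded. The tails of [b] bound the pointwise tails by a multiple of
    [norm x], which turns pointwise convergence into convergence in operator norm. *)
Lemma ex_series_bdop {X : CompleteNormedModule C_AbsRing} (c : nat -> bdop X)
    (b : nat -> R) :
  (forall k, norm (c k) <= b k) -> ex_series b -> ex_series c.
Proof.
intros Hc [B HB].
assert (Hcx : forall (x : X) k, norm (c k x) <= b k * norm x).
{ intros x k. eapply Rle_trans; [apply bdop_norm_bound|].
  apply Rmult_le_compat_r; [apply norm_ge_0|apply Hc]. }
assert (Hbx : forall r, is_series (fun k => b k * r) (B * r)).
{ intro r. exact (is_series_scal_r r b B HB). }
set (g := fun x : X => epsilon (inhabits x) (fun y : X => is_series (fun k => c k x) y)).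
assert (Hg : forall x, is_series (fun k => c k x) (g x)).
{ intro x. apply epsilon_spec.
  apply (ex_series_le _ (fun k => b k * norm x)); [apply Hcx|].
  eexists; apply Hbx. }
assert (HB0 : 0 <= B).
{ eapply Rle_trans; [apply (norm_ge_0 (V := R_NormedModule) B)|].
  apply (norm_is_series_le (V := R_NormedModule) b b B B); try assumption.
  intro k. change (Rabs (b k) <= b k). rewrite Rabs_pos_eq; [lra|].
  exact (Rle_trans _ _ _ (norm_ge_0 (c _)) (Hc _)). }
assert (Lg : is_linear g).
{ split.
  - intros x y. apply (is_series_eq (fun k => c k (plus x y))); [apply Hg|].
    apply is_series_ext with (fun k => plus (c k x) (c k y)).
    + intro k. symmetry. apply linear_plus, bdop_linear.
    + apply @is_series_plus; apply Hg.
  - intros r x. apply (is_series_eq (fun k => c k (scal r x))); [apply Hg|].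
    apply is_series_ext with (fun k => scal r (c k x)).
    + intro k. symmetry. apply (linear_scal _ (bdop_linear (c k))).
    + apply @is_series_scal; apply Hg.
  - exists (B + 1). split; [lra|]. intro x.
    generalize (norm_is_series_le _ _ _ _ (Hcx x) (Hg x) (Hbx (norm x))) (norm_ge_0 x).
    nra. }
exists (Bdop g Lg).
assert (Tail : forall n, norm (minus (sum_n c n) (Bdop g Lg)) <= B - sum_n b n).
{ intro n.
  assert (Tb : forall r, is_series (fun k => b (S n + k)%nat * r) ((B - sum_n b n) * r)).
  { intro r. apply (is_series_scal_r r (fun k => b (S n + k)%nat)).
    apply (is_series_incr_n (V := R_NormedModule) b (S n)); [lia|].
    simpl Nat.pred. refine (eq_ind _ (is_series b) HB _ _).
    change (B = B - sum_n b n + sum_n b n). lra. }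
  assert (Tx : forall x : X, norm (minus (sum_n c n x) (g x)) <= (B - sum_n b n) * norm x).
  { intro x. rewrite <- norm_opp, opp_minus.
    refine (norm_is_series_le _ _ _ _ (fun k => Hcx x (S n + k)%nat) _ (Tb (norm x))).
    apply (is_series_incr_n (fun k => c k x) (S n)); [lia|].
    simpl Nat.pred. rewrite <- sum_n_bdop. unfold minus.
    rewrite <- plus_assoc, (plus_opp_l (G := NormedModule.AbelianGroup _ X)), plus_zero_r.
    apply Hg. }
  apply bdop_norm_le; [|exact Tx].
  (* [bdop_norm_le] asks for a nonnegative bound: the tail of [b] dominates its own absolute value,
     its terms being at least [norm (c _)]. *)
  eapply Rle_trans; [apply (norm_ge_0 (V := R_NormedModule) (B - sum_n b n))|].
  apply (norm_is_series_le (V := R_NormedModule) (fun k => b (S n + k)%nat * 1)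
           (fun k => b (S n + k)%nat * 1) (B - sum_n b n)).
  - intro k. change (Rabs (b (S n + k)%nat * 1) <= b (S n + k)%nat * 1).
    rewrite Rabs_pos_eq; [lra|]. rewrite Rmult_1_r.
    exact (Rle_trans _ _ _ (norm_ge_0 (c _)) (Hc _)).
  - generalize (Tb 1). now rewrite Rmult_1_r.
  - generalize (Tb 1). now rewrite Rmult_1_r. }
intros P [e He].
destruct (HB (fun s => Rabs (s - B) < e)) as [n0 Hn0].
{ exists e. intros y Hy. exact Hy. }
exists n0. intros n Hn. apply He.
change (norm (minus (sum_n c n) (Bdop g Lg)) < e).
eapply Rle_lt_trans; [apply Tail|].
apply Rle_lt_trans with (Rabs (sum_n b n - B)); [|exact (Hn0 n Hn)].
rewrite Rabs_minus_sym. apply Rle_abs.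
Qed.

(** * Scalar estimates for the exponential *)

(* The remainder is a polynomial in s and h with nonnegative coefficients. At k = 0 the
   truncation [pred 0 = 0] is harmless because of the factor [INR 0]. *)
Lemma pow_taylor2_bound (s h : R) (k : nat) :
  Rabs ((s + h) ^ k - s ^ k - INR k * h * s ^ pred k) <=
  (Rabs s + Rabs h) ^ k - Rabs s ^ k - INR k * Rabs h * Rabs s ^ pred k.
Proof.
assert (Hs := Rabs_pos s). assert (Hh := Rabs_pos h).
induction k as [|k IH].
- simpl. rewrite Rabs_right; lra.
- assert (Rec : forall s h, (s + h) ^ S k - s ^ S k - INR (S k) * h * s ^ pred (S k) =
    (s + h) * ((s + h) ^ k - s ^ k - INR k * h * s ^ pred k)
    + INR k * h * h * s ^ pred k).
  { intros s' h'. rewrite S_INR. destruct k; simpl; ring. }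
  rewrite !Rec. eapply Rle_trans; [apply Rabs_triang|]. rewrite !Rabs_mult.
  rewrite (Rabs_pos_eq (INR k)), <- RPow_abs by apply pos_INR.
  apply Rplus_le_compat_r.
  apply Rmult_le_compat; try apply Rabs_pos; [apply Rabs_triang|exact IH].
Qed.

Lemma is_series_exp (x : R) : is_series (fun k => x ^ k / INR (fact k)) (exp x).
Proof.
apply is_series_ext with (2 := is_exp_Reals x). intro k.
rewrite pow_n_pow. reflexivity.
Qed.

(** Since [exp] has derivative 1 at 0, the remainder is [o(u)]; [u = 0] is split off because the
    difference quotient divides by [u]. *)
Lemma exp_small (d : R) : 0 < d ->
  exists e, 0 < e /\ forall u, 0 <= u < e -> exp u - 1 - u <= d * u.
Proof.
intro Hd. destruct (derivable_pt_lim_exp 0 d Hd) as [e He].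
exists e. split; [apply cond_pos|]. intros u [Hu0 Hu].
destruct Hu0 as [Hu0|<-]; [|rewrite exp_0; lra].
generalize (He u ltac:(lra) ltac:(rewrite Rabs_pos_eq; lra)).
rewrite exp_0, Rplus_0_l. intro H. apply Rabs_def2 in H.
replace (exp u - 1 - u) with (((exp u - 1) / u - 1) * u) by (field; lra).
apply Rmult_le_compat_r; lra.
Qed.

Lemma scal_minus_distr_r {V : ModuleSpace R_Ring} (x y : R) (u : V) :
  scal (x - y) u = minus (scal x u) (scal y u).
Proof. unfold minus. rewrite <- scal_opp_l. exact (scal_distr_r x (- y) u). Qed.

(** * Differentiation of exponential series with geometrically bounded coefficients *)

Section ExponentialSeries.

Context {V : NormedModule R_AbsRing}.
Context (c : nat -> V) (M : R) (F G : R -> V) (M_ge0 : 0 <= M)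
  (c_bound : forall k, norm (c k) <= M ^ k)
  (F_series : forall s, is_series (fun k => scal (s ^ k / INR (fact k)) (c k)) (F s))
  (G_series : forall s, is_series (fun k => scal (s ^ k / INR (fact k)) (c (S k))) (G s)).

(** Termwise, [pow_taylor2_bound] bounds the remainder of [s ^ k]. Weighted by [M ^ k / k!], these
    bounds sum to the same remainder for the scalar function [exp (M * x)] at [Rabs s] with
    increment [Rabs h], which factors. *)
Lemma exp_series_taylor2 (s h : R) :
  norm (minus (minus (F (s + h)) (F s)) (scal h (G s)))
  <= exp (M * Rabs s) * (exp (M * Rabs h) - 1 - M * Rabs h).
Proof.
set (b := fun x y k => ((x + y) ^ k - x ^ k - INR k * y * x ^ pred k) / INR (fact k)).
assert (shift : forall k y z, INR (S k) * y * z ^ k / INR (fact (S k)) = y * (z ^ k / INR (fact k))).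
{ intros k y z. change (fact (S k)) with (S k * fact k)%nat.
  rewrite mult_INR. field. split; [apply INR_fact_neq_0|apply not_0_INR; lia]. }
apply (norm_is_series_le (fun k => scal (b s h k) (c k))
         (fun k => M ^ k * b (Rabs s) (Rabs h) k)).
- intro k. eapply Rle_trans; [apply @norm_scal|]. rewrite Rmult_comm.
  apply Rmult_le_compat; [apply norm_ge_0|apply Rabs_pos|apply c_bound|].
  change (Rabs (b s h k) <= b (Rabs s) (Rabs h) k). unfold b, Rdiv.
  rewrite Rabs_mult, (Rabs_pos_eq (/ _)).
  + apply Rmult_le_compat_r; [|apply pow_taylor2_bound].
    left; apply Rinv_0_lt_compat, INR_fact_lt_0.
  + left; apply Rinv_0_lt_compat, INR_fact_lt_0.
(* The linear term has the factor [INR 0] at [k = 0], so its series may be started at [k = 1]. *)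
- assert (HG : is_series (fun k => scal (INR k * h * s ^ pred k / INR (fact k)) (c k))
                 (scal h (G s))).
  { apply is_series_decr_1.
    replace (plus _ _) with (scal h (G s)).
    - apply is_series_ext with (2 := is_series_scal h _ _ (G_series s)). intro k.
      rewrite scal_assoc. f_equal. symmetry. apply shift.
    - simpl (INR 0). rewrite !Rmult_0_l. unfold Rdiv. rewrite Rmult_0_l.
      rewrite (scal_zero_l (V := NormedModule.ModuleSpace _ V)).
      symmetry. exact (minus_zero_r (G := NormedModule.AbelianGroup _ V) _). }
  refine (is_series_ext _ _ _ _ (is_series_minus _ _ _ _
            (is_series_minus _ _ _ _ (F_series (s + h)) (F_series s)) HG)).
  intro k. replace (b s h k) with ((s + h) ^ k / INR (fact k) - s ^ k / INR (fact k)
    - INR k * h * s ^ pred k / INR (fact k)) by (unfold b, Rdiv; ring).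
  rewrite !(scal_minus_distr_r (V := NormedModule.ModuleSpace _ V)). reflexivity.
- assert (HG : is_series (fun k => M ^ k * (INR k * Rabs h * Rabs s ^ pred k / INR (fact k)))
                 (M * Rabs h * exp (M * Rabs s))).
  { apply is_series_decr_1.
    refine (eq_ind _ (is_series _) (is_series_ext _ _ _ _
       (is_series_scal (M * Rabs h) _ _ (is_series_exp (M * Rabs s)))) _ _).
    - intro k. rewrite Nat.pred_succ, shift, Rpow_mult_distr.
      change (M * Rabs h * (M ^ k * Rabs s ^ k / INR (fact k)) =
        M * M ^ k * (Rabs h * (Rabs s ^ k / INR (fact k)))).
      unfold Rdiv; ring.
    - change (M * Rabs h * exp (M * Rabs s) = M * Rabs h * exp (M * Rabs s)
       + - (1 * (0 * Rabs h * 1 / 1))). field. }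
  replace (exp (M * Rabs s) * (exp (M * Rabs h) - 1 - M * Rabs h)) with
    (exp (M * (Rabs s + Rabs h)) - exp (M * Rabs s) - M * Rabs h * exp (M * Rabs s))
    by (rewrite Rmult_plus_distr_l, exp_plus; ring).
  refine (is_series_ext _ _ _ _ (is_series_minus _ _ _ _ (is_series_minus _ _ _ _
     (is_series_exp (M * (Rabs s + Rabs h))) (is_series_exp (M * Rabs s))) HG)).
  intro k. rewrite !Rpow_mult_distr. unfold b.
  match goal with |- plus (plus ?x (opp ?y)) (opp ?z) = ?w => change (x - y - z = w :> R) end.
  unfold Rdiv. ring.
Qed.

Lemma exp_series_derive (s d : R) : 0 < d ->
  exists e, 0 < e /\ forall s', Rabs (s' - s) < e ->
    norm (minus (minus (F s') (F s)) (scal (s' - s) (G s))) <= d * Rabs (s' - s).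
Proof.
intro Hd. assert (He := exp_pos (M * Rabs s)).
(* [d'] absorbs the factor [exp (M * Rabs s)]; dividing by [M + 1] instead of [M] allows [M = 0]. *)
set (d' := d / (exp (M * Rabs s) * (M + 1))).
assert (Hd' : 0 < d') by (apply Rdiv_lt_0_compat; nra).
assert (Hdd : exp (M * Rabs s) * d' * (M + 1) = d) by (unfold d'; field; lra).
destruct (exp_small d' Hd') as [e [He0 He1]].
exists (e / (M + 1)). split; [apply Rdiv_lt_0_compat; lra|].
intros s' Hs'. assert (H0 := Rabs_pos (s' - s)).
assert (Hm : (M + 1) * Rabs (s' - s) < e).
{ replace e with ((M + 1) * (e / (M + 1))) by (field; lra).
  apply Rmult_lt_compat_l; lra. }
assert (H := exp_series_taylor2 s (s' - s)).
replace (s + (s' - s)) with s' in H by ring.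
eapply Rle_trans; [exact H|].
apply Rle_trans with (exp (M * Rabs s) * (d' * (M * Rabs (s' - s)))).
- apply Rmult_le_compat_l; [lra|]. apply He1. nra.
- rewrite <- Hdd.
  replace (exp (M * Rabs s) * d' * (M + 1) * Rabs (s' - s)) with
    (exp (M * Rabs s) * (d' * (M * Rabs (s' - s))) + exp (M * Rabs s) * (d' * Rabs (s' - s)))
    by ring.
  assert (0 <= exp (M * Rabs s) * (d' * Rabs (s' - s))); [|lra].
  apply Rmult_le_pos; [lra|]. apply Rmult_le_pos; lra.
Qed.

End ExponentialSeries.

(** * Derivatives and limits relative to a subset of the line *)

Lemma locally_R_iff (t : R) (P : R -> Prop) :
  locally t P <-> exists e, 0 < e /\ forall s, Rabs (s - t) < e -> P s.
Proof.
split.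
- intros [e He]. exists e. split; [apply cond_pos|]. intros s Hs. apply He, Hs.
- intros [e [He H]]. exists (mkposreal e He). intros s Hs. apply H, Hs.
Qed.

Section WithinDerivative.

Context {V : NormedModule R_AbsRing}.

Lemma filterdiff_within (D : R -> Prop) (f : R -> V) (t : R) (L : V) :
  (forall d, 0 < d -> exists e, 0 < e /\ forall s, D s -> Rabs (s - t) < e ->
     norm (minus (minus (f s) (f t)) (scal (s - t) L)) <= d * Rabs (s - t)) ->
  D t ->
  filterdiff f (within D (locally t)) (fun h : R => scal h L).
Proof.
intros H Dt. split; [exact (is_linear_scal_l L)|].
intros x Hx.
(* [filterdiff] quantifies over every limit point of the filter. Since [D t] holds, [t] lies in
   every set of the filter, so a limit point [x] has [t] in each of its neighbourhoods. *)
assert (E : x = t).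
{ destruct (Req_dec x t) as [E|E]; [exact E|exfalso].
  assert (Hp : 0 < Rabs (x - t)) by (apply Rabs_pos_lt; lra).
  assert (HP : within D (locally t) (fun s => Rabs (s - x) < Rabs (x - t))).
  { apply Hx, locally_R_iff. exists (Rabs (x - t)). auto. }
  apply locally_R_iff in HP. destruct HP as [e [He HP]].
  specialize (HP t). rewrite Rminus_diag, Rabs_R0, Rabs_minus_sym in HP.
  specialize (HP He Dt). lra. }
subst x. intro d. apply locally_R_iff.
destruct (H d (cond_pos d)) as [e [He He']].
exists e. split; [exact He|]. intros s Hs Ds. exact (He' s Ds Hs).
Qed.

Lemma filterdiff_within_elim (D : R -> Prop) (f : R -> V) (t : R) (L : V) :
  filterdiff f (within D (locally t)) (fun h : R => scal h L) ->
  forall d, 0 < d -> exists e, 0 < e /\ forall s, D s -> Rabs (s - t) < e ->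
     norm (minus (minus (f s) (f t)) (scal (s - t) L)) <= d * Rabs (s - t).
Proof.
intros [_ H] d Hd.
assert (H1 := H t (fun P HP => filter_le_within _ P HP) (mkposreal d Hd)).
apply locally_R_iff in H1. destruct H1 as [e [He H1]].
exists e. split; [exact He|]. intros s Ds Hs. exact (H1 s Hs Ds).
Qed.

Lemma filterdiff_within_subset (D D' : R -> Prop) (f : R -> V) (t : R) (L : V) :
  (forall s, D' s -> D s) -> D' t ->
  filterdiff f (within D (locally t)) (fun h : R => scal h L) ->
  filterdiff f (within D' (locally t)) (fun h : R => scal h L).
Proof.
intros HD Dt H. apply filterdiff_within; [|exact Dt]. intros d Hd.
destruct (filterdiff_within_elim _ _ _ _ H d Hd) as [e [He He']].
exists e. auto.
Qed.

Lemma filterdiff_within_continuous (D : R -> Prop) (f : R -> V) (t : R) (l : R -> V) :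
  filterdiff f (within D (locally t)) l ->
  filterlim f (within D (locally t)) (locally (f t)).
Proof.
intro H. apply filterdiff_continuous_aux; [now exists l|].
intros P HP. exact (filter_le_within _ P HP).
Qed.

Lemma filterdiff_sum_n (F : (R -> Prop) -> Prop) {FF : Filter F}
    (f : nat -> R -> V) (L : nat -> V) (n : nat) :
  (forall l, (l <= n)%nat -> filterdiff (f l) F (fun h : R => scal h (L l))) ->
  filterdiff (fun t => sum_n (fun l => f l t) n) F (fun h : R => scal h (sum_n L n)).
Proof.
induction n as [|n IH]; intros H.
- rewrite sum_O. apply filterdiff_ext with (f 0%nat); [|apply H; lia].
  intro t. now rewrite sum_O.
- rewrite sum_Sn.
  apply filterdiff_ext with (fun t => plus (sum_n (fun l => f l t) n) (f (S n) t)).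
  { intro t. now rewrite sum_Sn. }
  apply filterdiff_ext_lin with (fun h : R => plus (scal h (sum_n L n)) (scal h (L (S n)))).
  { apply (filterdiff_plus_fct (F := F)); [apply IH; intros; apply H|apply H]; lia. }
  intro h. symmetry. exact (scal_distr_l (h : R_AbsRing) (sum_n L n) (L (S n))).
Qed.

Lemma filterlim_sum_n {T : Type} (F : (T -> Prop) -> Prop) {FF : Filter F}
    (f : nat -> T -> V) (L : nat -> V) (n : nat) :
  (forall l, (l <= n)%nat -> filterlim (f l) F (locally (L l))) ->
  filterlim (fun t => sum_n (fun l => f l t) n) F (locally (sum_n L n)).
Proof.
induction n as [|n IH]; intros H.
- rewrite sum_O. apply filterlim_ext with (f 0%nat); [|apply H; lia].
  intro t. now rewrite sum_O.
- rewrite sum_Sn.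
  apply filterlim_ext with (fun t => plus (sum_n (fun l => f l t) n) (f (S n) t)).
  { intro t. now rewrite sum_Sn. }
  refine (filterlim_comp_2 _ _ _ _ _ (filterlim_plus _ _));
    [apply IH; intros; apply H|apply H]; lia.
Qed.

Lemma is_series_pow_0 (c : nat -> V) :
  is_series (fun k => scal (0 ^ k / INR (fact k)) (c k)) (c 0%nat).
Proof.
apply filterlim_ext with (fun _ : nat => c 0%nat); [|apply filterlim_const].
intro n. symmetry. induction n as [|n IH].
- rewrite sum_O. simpl. rewrite Rdiv_1_r. exact (scal_one (V := NormedModule.ModuleSpace _ V) _).
- rewrite sum_Sn, IH. simpl (0 ^ _). unfold Rdiv. rewrite !Rmult_0_l.
  rewrite (scal_zero_l (V := NormedModule.ModuleSpace _ V)). apply plus_zero_r.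
Qed.

End WithinDerivative.

(** * Recurrence and growth of the coefficients [Qop] *)

Section QCoefficients.

Context {X : NormedModule C_AbsRing} (A0 A1 : bdop X).

(** The defining sum runs from [l] to [k] and is empty. *)
Lemma Qop_lt (k l : nat) : (k < l)%nat -> Qop A0 A1 (S k) l = zero.
Proof. destruct l; [lia|]. intro H. simpl. apply sum_n_m_zero. lia. Qed.

(** The last summand [m = k + 1] is the [A1] term; every other summand has a factor [A0] to pull out
    on the left. This is the differential equation of the pieces read on coefficients. *)
Lemma Qop_SS (k l : nat) :
  Qop A0 A1 (S (S k)) (S l) =
  plus (mult A0 (Qop A0 A1 (S k) (S l))) (mult A1 (Qop A0 A1 (S k) l)).
Proof.
destruct (Nat.le_gt_cases l k) as [H|H].
- assert (E : forall k, Qop A0 A1 (S k) (S l) =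
    sum_n_m (fun m => mult (mult (pow_n A0 (k - m)) A1) (Qop A0 A1 m l)) (S l) k)
    by reflexivity.
  rewrite !E, sum_n_Sm by lia. f_equal.
  + rewrite <- (sum_n_m_mult_l (K := bdop_Ring)).
    apply sum_n_m_ext_loc. intros m Hm. rewrite Nat.sub_succ_l by lia.
    simpl pow_n. rewrite !(mult_assoc (K := bdop_Ring)). reflexivity.
  + rewrite Nat.sub_diag. simpl pow_n. now rewrite (mult_one_l (K := bdop_Ring)).
- rewrite !Qop_lt by lia.
  rewrite !bdop_mult_zero_r. symmetry. apply plus_zero_r.
Qed.

(** Induction on [k] through [Qop_SS], with [l] kept general because the second term of the
    recurrence lowers it. *)
Lemma norm_Qop_le (k l : nat) : norm (Qop A0 A1 (S k) l) <= (norm A0 + norm A1) ^ k.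
Proof.
revert l. assert (H0 := norm_ge_0 A0). assert (H1 := norm_ge_0 A1).
assert (Hm : forall f g : bdop X, norm (mult f g) <= norm f * norm g)
  by exact bdop_norm_mult.
induction k as [|k IH]; intros [|l].
- apply norm_bdop_one.
- rewrite Qop_lt by lia. rewrite norm_bdop_zero. simpl; lra.
- change (norm (mult A0 (Qop A0 A1 (S k) 0)) <= (norm A0 + norm A1) ^ S k).
  eapply Rle_trans; [apply Hm|].
  generalize (IH 0%nat) (norm_ge_0 (Qop A0 A1 (S k) 0)). simpl pow. nra.
- rewrite Qop_SS. eapply Rle_trans; [apply @norm_triangle|].
  generalize (Hm A0 (Qop A0 A1 (S k) (S l))) (Hm A1 (Qop A0 A1 (S k) l))
    (IH (S l)) (IH l). simpl pow. nra.
Qed.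

End QCoefficients.

(** * The pieces [V_l] and their cut-offs at zero *)

Section Pieces.

Context {X : CompleteNormedModule C_AbsRing} (A0 A1 : bdop X).

(** This is [V_l], a chosen sum of its series for every real [s], negative ones included. *)
Definition delay_piece (l : nat) (s : R) : bdop X :=
  epsilon (inhabits zero)
    (is_series (fun k => scal (s ^ k / INR (fact k)) (Qop A0 A1 (S k) l))).

Lemma delay_piece_series l s :
  is_series (fun k => scal (s ^ k / INR (fact k)) (Qop A0 A1 (S k) l)) (delay_piece l s).
Proof.
unfold delay_piece. apply epsilon_spec.
set (M := norm A0 + norm A1).
apply ex_series_bdop with (fun k => (M * Rabs s) ^ k / INR (fact k)).
- intro k. eapply Rle_trans; [apply @norm_scal|].
  change (Rabs (s ^ k / INR (fact k)) * norm (Qop A0 A1 (S k) l)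
    <= (M * Rabs s) ^ k / INR (fact k)).
  assert (Hf := Rinv_0_lt_compat _ (INR_fact_lt_0 k)).
  unfold Rdiv. rewrite Rabs_mult, (Rabs_pos_eq (/ _)), <- RPow_abs, Rpow_mult_distr by lra.
  replace (M ^ k * Rabs s ^ k * / INR (fact k)) with
    (Rabs s ^ k * / INR (fact k) * M ^ k) by ring.
  apply Rmult_le_compat_l; [|apply norm_Qop_le].
  apply Rmult_le_pos; [apply pow_le, Rabs_pos|lra].
- eexists. apply is_series_exp.
Qed.

Lemma delay_piece_0 l : delay_piece l 0 = Qop A0 A1 1 l.
Proof. exact (is_series_eq _ _ _ (delay_piece_series l 0) (is_series_pow_0 _)). Qed.

(** The convention [V_{-1} = 0], which lets the equation [V_l' = A0 V_l + A1 V_{l-1}] cover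
    [l = 0]. *)
Definition shift_index (W : nat -> R -> bdop X) (l : nat) (s : R) : bdop X :=
  match l with O => zero | S l' => W l' s end.

(** The series with coefficients shifted by one is the derivative, and [Qop_SS] splits it into the
    [A0] and [A1] parts; for [l = 0] the coefficients are powers of [A0] and only the first part
    occurs. *)
Lemma delay_piece_derive l s d : 0 < d ->
  exists e, 0 < e /\ forall s', Rabs (s' - s) < e ->
    norm (minus (minus (delay_piece l s') (delay_piece l s))
      (scal (s' - s) (plus (mult A0 (delay_piece l s))
                           (mult A1 (shift_index delay_piece l s)))))
    <= d * Rabs (s' - s).
Proof.
apply (exp_series_derive (fun k => Qop A0 A1 (S k) l) (norm A0 + norm A1)
  (delay_piece l)
  (fun s => plus (mult A0 (delay_piece l s)) (mult A1 (shift_index delay_piece l s)))).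
- generalize (norm_ge_0 A0) (norm_ge_0 A1). lra.
- intro k. apply norm_Qop_le.
- apply delay_piece_series.
- clear s. intro s.
  assert (HA0 := is_series_linear _ _ _ (is_linear_mult_l A0) (delay_piece_series l s)).
  destruct l as [|l].
  + simpl shift_index. rewrite bdop_mult_zero_r, plus_zero_r.
    apply is_series_ext with (2 := HA0). intro k.
    exact (linear_scal _ (is_linear_mult_l A0) _ (Qop A0 A1 (S k) 0)).
  + assert (HA1 := is_series_linear _ _ _ (is_linear_mult_l A1) (delay_piece_series l s)).
    apply is_series_ext with (2 := is_series_plus _ _ _ _ HA0 HA1). intro k.
    rewrite Qop_SS, (linear_scal _ (is_linear_mult_l A0)), (linear_scal _ (is_linear_mult_l A1)).
    symmetry. exact (scal_distr_l (V := bdop_ModuleSpace) _ _ _).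
Qed.

Definition delay_piece_cut (l : nat) (s : R) : bdop X :=
  if Rle_dec 0 s then delay_piece l s else zero.

Lemma delay_piece_cut_ge l s : 0 <= s -> delay_piece_cut l s = delay_piece l s.
Proof. unfold delay_piece_cut. destruct Rle_dec; [reflexivity|lra]. Qed.

Lemma delay_piece_cut_lt l s : s < 0 -> delay_piece_cut l s = zero.
Proof. unfold delay_piece_cut. destruct Rle_dec; [lra|reflexivity]. Qed.

(** At [s = 0] the value is the coefficient [Qop A0 A1 1 (S l)], an empty sum. *)
Lemma delay_piece_cut_le l s : s <= 0 -> delay_piece_cut (S l) s = zero.
Proof.
intros [H| ->]; [now apply delay_piece_cut_lt|].
rewrite delay_piece_cut_ge, delay_piece_0 by lra. apply Qop_lt. lia.
Qed.

(* At s = 0 the piece l = 0 jumps and l = 1 has a corner; for l >= 2 both V_l(0) and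
   V_l'(0) = A0 V_l(0) + A1 V_{l-1}(0) vanish. *)
Lemma delay_piece_cut_derive l s d : 0 < d ->
  exists e, 0 < e /\ forall s', (s = 0 -> (l <= 1)%nat -> 0 <= s') -> Rabs (s' - s) < e ->
    norm (minus (minus (delay_piece_cut l s') (delay_piece_cut l s))
      (scal (s' - s) (plus (mult A0 (delay_piece_cut l s))
                           (mult A1 (shift_index delay_piece_cut l s)))))
    <= d * Rabs (s' - s).
Proof.
intro Hd. destruct (delay_piece_derive l s d Hd) as [e [He H]].
assert (Flat : forall s', delay_piece_cut l s' = zero -> delay_piece_cut l s = zero ->
  shift_index delay_piece_cut l s = zero ->
  norm (minus (minus (delay_piece_cut l s') (delay_piece_cut l s))
      (scal (s' - s) (plus (mult A0 (delay_piece_cut l s))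
                           (mult A1 (shift_index delay_piece_cut l s)))))
    <= d * Rabs (s' - s)).
{ intros s' -> -> ->. rewrite !bdop_mult_zero_r, plus_zero_r.
  rewrite bdop_scal_zero_r, !bdop_minus_zero_r, norm_bdop_zero.
  generalize (Rabs_pos (s' - s)). nra. }
destruct (Rtotal_order s 0) as [Hs|[Hs|Hs]].
- exists (- s). split; [lra|]. intros s' _ Hs'. apply Rabs_def2 in Hs'.
  apply Flat; [apply delay_piece_cut_lt; lra..|].
  destruct l; [reflexivity|]. apply delay_piece_cut_lt, Hs.
- exists e. split; [exact He|]. intros s' Ds' Hs'.
  destruct (Rle_lt_dec 0 s') as [P|P].
  + rewrite !delay_piece_cut_ge by lra.
    replace (shift_index delay_piece_cut l s) with (shift_index delay_piece l s);
      [now apply H|].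
    destruct l; [reflexivity|]. symmetry. apply delay_piece_cut_ge; lra.
  + destruct l as [|[|l]]; try (specialize (Ds' Hs ltac:(lia)); lra).
    apply Flat; apply delay_piece_cut_le; lra.
- exists (Rmin e s). split; [now apply Rmin_pos|]. intros s' _ Hs'.
  assert (Hs1 := Rlt_le_trans _ _ _ Hs' (Rmin_l _ _)).
  assert (Hs2 := Rlt_le_trans _ _ _ Hs' (Rmin_r _ _)). apply Rabs_def2 in Hs2.
  rewrite !delay_piece_cut_ge by lra.
  replace (shift_index delay_piece_cut l s) with (shift_index delay_piece l s);
    [now apply H|].
  destruct l; [reflexivity|]. symmetry. apply delay_piece_cut_ge; lra.
Qed.

Lemma delay_piece_continuous l s : continuous (delay_piece l) s.
Proof.
assert (H : filterdiff (delay_piece l) (within (fun _ => True) (locally s))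
  (fun h : R => scal h (plus (mult A0 (delay_piece l s))
                             (mult A1 (shift_index delay_piece l s))))).
{ refine (filterdiff_within (fun _ => True) (delay_piece l) s _ _ I). intros d Hd.
  destruct (delay_piece_derive l s d Hd) as [e [He H]]. eauto. }
intros P HP. assert (HP' := filterdiff_within_continuous _ _ _ _ H P HP).
exact (filter_imp (F := locally s) _ (fun r => P (delay_piece l r)) (fun r Hr => Hr I) HP').
Qed.

(** Since [V_l(0) = 0] for [l >= 1], cutting off amounts to evaluating [V_l] at [Rmax 0 s]. *)
Lemma delay_piece_cut_continuous l s : (1 <= l)%nat -> continuous (delay_piece_cut l) s.
Proof.
intro Hl. apply continuous_ext with (fun r => delay_piece l (Rmax 0 r)).
- intro r. unfold Rmax. destruct l as [|l]; [lia|].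
  destruct Rle_dec; [symmetry; now apply delay_piece_cut_ge|].
  rewrite delay_piece_cut_le, delay_piece_0 by lra. apply Qop_lt. lia.
- apply continuous_comp; [|apply delay_piece_continuous].
  intros P HP. apply locally_R_iff in HP. destruct HP as [e [He HP]].
  apply locally_R_iff. exists e. split; [exact He|]. intros r Hr. apply HP.
  eapply Rle_lt_trans; [|exact Hr].
  unfold Rmax. repeat destruct Rle_dec; unfold Rabs; repeat destruct Rcase_abs; lra.
Qed.

End Pieces.

(** * The fundamental solution as a finite sum of shifted pieces *)

Section Solution.

Context {X : CompleteNormedModule C_AbsRing} (A0 A1 : bdop X) (tau : R) (tau_pos : 0 < tau).

Definition delay_sum (n : nat) (t : R) : bdop X :=
  sum_n (fun l => delay_piece_cut A0 A1 l (t - INR l * tau)) n.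

(** A piece of index [j > n] is evaluated at [t - j tau <= 0], where its cut-off vanishes. *)
Lemma delay_sum_stationary (n m : nat) (t : R) :
  (n <= m)%nat -> t <= INR (n + 1) * tau -> delay_sum m t = delay_sum n t.
Proof.
intros Hnm Ht. induction Hnm as [|m Hnm IH]; [reflexivity|].
rewrite <- IH. unfold delay_sum. rewrite sum_Sn, delay_piece_cut_le.
- apply plus_zero_r.
- assert (INR (n + 1) <= INR (S m)) by (apply le_INR; lia). nra.
Qed.

(** Translated form of [delay_piece_cut_derive]. When [t] sits at the jump of piece 0 or the corner
    of piece 1, the condition on [D] admits only points [s] that are not to its left. *)
Lemma delay_piece_shift_derive (D : R -> Prop) (l : nat) (t : R) :
  D t ->
  (forall s, D s -> t - INR l * tau = 0 -> (l <= 1)%nat -> 0 <= s - INR l * tau) ->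
  filterdiff (fun s => delay_piece_cut A0 A1 l (s - INR l * tau)) (within D (locally t))
    (fun h : R => scal h
       (plus (mult A0 (delay_piece_cut A0 A1 l (t - INR l * tau)))
             (mult A1 (shift_index (delay_piece_cut A0 A1) l (t - INR l * tau))))).
Proof.
intros Dt HD.
refine (filterdiff_within D (fun s => delay_piece_cut A0 A1 l (s - INR l * tau)) t _ _ Dt).
intros d Hd.
destruct (delay_piece_cut_derive A0 A1 l (t - INR l * tau) d Hd) as [e [He H]].
exists e. split; [exact He|]. intros s Ds Hs.
replace (s - t) with (s - INR l * tau - (t - INR l * tau)) in Hs |- * by ring.
apply H; auto.
Qed.

(** The predecessor of piece [l] at [t - l tau] is piece [l - 1] at [(t - tau) - (l - 1) tau], so
    reindexing yields the delayed sum with one term fewer. *)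
Lemma delay_sum_derive_sum (n : nat) (t : R) :
  sum_n (fun l => plus (mult A0 (delay_piece_cut A0 A1 l (t - INR l * tau)))
    (mult A1 (shift_index (delay_piece_cut A0 A1) l (t - INR l * tau)))) (S n)
  = plus (mult A0 (delay_sum (S n) t)) (mult A1 (delay_sum n (t - tau))).
Proof.
assert (E : forall n, sum_n (fun l => shift_index (delay_piece_cut A0 A1) l (t - INR l * tau)) (S n)
  = delay_sum n (t - tau)).
{ clear n. unfold delay_sum. induction n as [|n IH].
  - rewrite sum_Sn, !sum_O. simpl shift_index. simpl INR.
    replace (t - tau - 0 * tau) with (t - 1 * tau) by ring. apply plus_zero_l.
  - rewrite sum_Sn, IH, (sum_Sn _ n). f_equal. unfold shift_index. f_equal.
    rewrite (S_INR (S n)). ring. }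
rewrite <- E. unfold delay_sum. rewrite !bdop_mult_sum_n. apply sum_n_plus.
Qed.

(* The piece of index N + 1 vanishes on [0, T]; it is included so that the delayed sum
   A1 S(t - tau) has all its terms even when N = 0 and t = T = tau. *)
Lemma delay_sum_fundamental (N : nat) :
  is_fundamental_solution A0 A1 tau (INR (N + 1) * tau) (delay_sum (S N)).
Proof.
split.
- intros t Ht. rewrite (delay_sum_stationary 0) by (simpl; lia || lra).
  unfold delay_sum. rewrite sum_O. apply delay_piece_cut_lt. simpl. lra.
- rewrite (delay_sum_stationary 0) by (simpl; lia || lra).
  unfold delay_sum. rewrite sum_O. simpl INR. rewrite Rmult_0_l, Rminus_0_r.
  rewrite delay_piece_cut_ge by lra. exact (delay_piece_0 A0 A1 0).
- intros t Ht.
  apply (filterlim_sum_n _ (fun l s => delay_piece_cut A0 A1 l (s - INR l * tau))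
    (fun l => delay_piece_cut A0 A1 l (t - INR l * tau))).
  (* Only piece 0 needs the restriction to [[0, T]], because it jumps at 0; the later pieces are
     continuous on the whole line. *)
  intros [|l] _.
  + refine (filterdiff_within_continuous _ _ _ _ (delay_piece_shift_derive _ 0 t Ht _)).
    intros s Hs _ _. simpl. lra.
  + eapply filterlim_filter_le_1; [apply filter_le_within|].
    apply (continuous_comp (fun s => s - INR (S l) * tau) (delay_piece_cut A0 A1 (S l))).
    * apply (continuous_minus (V := R_NormedModule)); [apply continuous_id|apply continuous_const].
    * apply delay_piece_cut_continuous. lia.
- intros t Ht.
  (* [delay_sum_derive_sum] yields the delayed sum up to index [N]; the piece of index [N + 1]
     vanishes at [t - tau]. *)
  assert (E : delay_sum (S N) (t - tau) = delay_sum N (t - tau)).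
  { apply delay_sum_stationary; [lia|]. lra. }
  rewrite E, <- delay_sum_derive_sum.
  apply (filterdiff_sum_n _ (fun l s => delay_piece_cut A0 A1 l (s - INR l * tau))).
  intros l _. apply delay_piece_shift_derive.
  + split; [exact Ht|lra].
  (* Piece 0 is protected by [0 <= s], piece 1 by the requirement [tau <= s] when [t = tau]. *)
  + intros s [Hs Hst] Ht0 Hl. destruct l as [|[|l]]; [| |lia]; simpl in *; lra.
Qed.

End Solution.

(** * Uniqueness by a Gronwall argument *)

(* Real induction on the bound u(t) <= eps exp((c + 1) t): the spare 1 in the rate
   absorbs the error d, taken equal to the bound K. *)
Lemma gronwall_right_derivative (u : R -> R) (c T : R) :
  0 <= c -> u 0 <= 0 ->
  (forall s d, 0 < s <= T -> 0 < d -> exists r, 0 <= r < s /\ u s <= u r + d) ->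
  (forall s K d, 0 <= s < T -> 0 <= K -> (forall r, 0 <= r <= s -> u r <= K) -> 0 < d ->
     exists e, 0 < e /\ forall r, s < r < s + e -> r <= T ->
       u r <= K + (r - s) * (c * K + d)) ->
  forall t, 0 <= t <= T -> u t <= 0.
Proof.
intros Hc H0 Hleft Hright.
assert (Claim : forall eps, 0 < eps -> forall t, 0 <= t <= T -> u t <= eps * exp ((c + 1) * t)).
{ intros eps Heps t Ht.
  set (B := fun s => eps * exp ((c + 1) * s)).
  assert (B_pos : forall s, 0 < B s) by (intro s; apply Rmult_lt_0_compat; [lra|apply exp_pos]).
  assert (B_le : forall r s, r <= s -> B r <= B s).
  { intros r s [H| ->]; [|lra]. apply Rmult_le_compat_l; [lra|].
    left. apply exp_increasing. nra. }
  set (E := fun s => 0 <= s <= T /\ forall r, 0 <= r <= s -> u r <= B r).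
  assert (E0 : E 0).
  { split; [lra|]. intros r Hr. replace r with 0 by lra. generalize (B_pos 0). lra. }
  destruct (completeness E) as [s [Hub Hlub]].
  { exists T. intros r [Hr _]. lra. }
  { now exists 0. }
  assert (Hs0 : 0 <= s) by now apply Hub.
  assert (HsT : s <= T) by (apply Hlub; intros r [Hr _]; lra).
  assert (Below : forall r, 0 <= r < s -> u r <= B r).
  { intros r Hr. destruct (Rle_lt_dec (u r) (B r)) as [H|H]; [exact H|exfalso].
    assert (Hle : s <= r); [|lra].
    apply Hlub. intros q [Hq Hq']. destruct (Rle_lt_dec q r) as [|Hrq]; [assumption|].
    specialize (Hq' r ltac:(lra)). lra. }
  assert (At : u s <= B s).
  { destruct Hs0 as [Hs0|<-]; [|apply E0; lra].
    destruct (Rle_lt_dec (u s) (B s)) as [H|H]; [exact H|exfalso].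
    (* If the bound failed at [s], taking half the excess as [d] would make it fail at an earlier
       time. *)
    destruct (Hleft s ((u s - B s) / 2) ltac:(lra) ltac:(lra)) as [r [Hr Hur]].
    generalize (Below r Hr) (B_le r s ltac:(lra)). lra. }
  assert (Upto : forall r, 0 <= r <= s -> u r <= B r).
  { intros r [Hr [Hr'| ->]]; [now apply Below|exact At]. }
  destruct HsT as [HsT|HsT]; [exfalso|subst s; now apply Upto].
  destruct (Hright s (B s) (B s) ltac:(lra)) as [e [He Hstep]].
  { left; apply B_pos. }
  { intros r Hr. eapply Rle_trans; [now apply Upto|now apply B_le]. }
  { apply B_pos. }
  set (q := Rmin (s + e / 2) T).
  assert (Hq1 := Rmin_l (s + e / 2) T). assert (Hq2 := Rmin_r (s + e / 2) T).
  assert (Hq : s < q) by (apply Rmin_glb_lt; lra). fold q in Hq1, Hq2.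
  assert (q <= s); [|lra].
  apply Hub. split; [lra|]. intros r Hr.
  destruct (Rle_lt_dec r s) as [Hrs|Hrs]; [apply Upto; lra|].
  eapply Rle_trans; [apply Hstep; lra|].
  (* The inequality [1 + x <= exp x] puts one linear step at rate [c + 1] below the exponential
     bound. *)
  assert (Hexp := exp_ineq1_le ((c + 1) * (r - s))).
  replace (B r) with (B s * exp ((c + 1) * (r - s))).
  { generalize (B_pos s). nra. }
  unfold B. rewrite Rmult_assoc, <- exp_plus. do 2 f_equal. ring. }
intros t Ht. destruct (Rle_lt_dec (u t) 0) as [H|H]; [exact H|exfalso].
assert (He := exp_pos ((c + 1) * t)).
(* This [eps] makes the bound at [t] equal to [u t / 2]. *)
assert (Heps : 0 < u t / (2 * exp ((c + 1) * t))) by (apply Rdiv_lt_0_compat; lra).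
generalize (Claim _ Heps t Ht).
replace (u t / (2 * exp ((c + 1) * t)) * exp ((c + 1) * t)) with (u t / 2) by (field; lra).
lra.
Qed.

Lemma minus_plus_plus {G : AbelianGroup} (a b c d : G) :
  minus (plus a b) (plus c d) = plus (minus a c) (minus b d).
Proof.
unfold minus. rewrite opp_plus, <- !plus_assoc. f_equal.
rewrite !plus_assoc. f_equal. apply plus_comm.
Qed.

Lemma plus_minus_l {G : AbelianGroup} (a b : G) : plus (minus a b) b = a.
Proof. unfold minus. now rewrite <- plus_assoc, plus_opp_l, plus_zero_r. Qed.

Lemma fundamental_solution_unique {X : NormedModule C_AbsRing} (A0 A1 : bdop X)
    (tau T : R) (S1 S2 : R -> bdop X) :
  0 < tau ->
  is_fundamental_solution A0 A1 tau T S1 ->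
  is_fundamental_solution A0 A1 tau T S2 ->
  forall t, 0 <= t <= T -> S1 t = S2 t.
Proof.
intros Htau H1 H2.
set (D := fun s => minus (S1 s) (S2 s)).
assert (Hm : forall f g : bdop X, norm (mult f g) <= norm f * norm g)
  by exact bdop_norm_mult.
assert (HA0 := norm_ge_0 A0). assert (HA1 := norm_ge_0 A1).
assert (D_zero : forall t, 0 <= t <= T -> norm (D t) <= 0).
{ apply (gronwall_right_derivative (fun s => norm (D s)) (norm A0 + norm A1)).
  - lra.
  - unfold D. rewrite (fs_init _ _ _ _ _ H1), (fs_init _ _ _ _ _ H2).
    rewrite (minus_eq_zero (G := bdop_AbelianGroup)). right. exact bdop_norm_zero.
  - intros s d Hs Hd.
    assert (HD : filterlim D (within (fun r => 0 <= r <= T) (locally s)) (locally (D s))).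
    { refine (filterlim_comp_2 _ _ _ _ _
        (filterlim_plus (S1 s) (opp (S2 s)))).
      - apply (fs_continuous _ _ _ _ _ H1); lra.
      - refine (filterlim_comp _ _ _ _ _ _ _ _ _ (filterlim_opp (S2 s))).
        apply (fs_continuous _ _ _ _ _ H2); lra. }
    assert (Hn := filterlim_comp _ _ _ _ _ _ _ _ HD (filterlim_norm (D s))).
    specialize (Hn (fun y => Rabs (y - norm (D s)) < d)).
    assert (Hl := proj1 (locally_R_iff _ _)
      (Hn (proj2 (locally_R_iff _ _) (ex_intro _ d (conj Hd (fun y Hy => Hy)))))).
    destruct Hl as [e [He Hl]].
    set (r := Rmax 0 (s - e / 2)).
    assert (Hr1 := Rmax_l 0 (s - e / 2)). assert (Hr2 := Rmax_r 0 (s - e / 2)).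
    assert (Hr : r < s) by (apply Rmax_lub_lt; lra). fold r in Hr1, Hr2.
    exists r. split; [lra|].
    specialize (Hl r). rewrite Rabs_left in Hl by lra.
    specialize (Hl ltac:(lra) ltac:(lra)). apply Rabs_def2 in Hl. lra.
  - intros s K d Hs HK Hu Hd.
    assert (HD : filterdiff D (within (fun r => s <= r <= T) (locally s))
      (fun h : R => scal h (plus (mult A0 (D s)) (mult A1 (D (s - tau)))))).
    { assert (Sub : forall S', is_fundamental_solution A0 A1 tau T S' ->
        filterdiff S' (within (fun r => s <= r <= T) (locally s))
          (fun h : R => scal h (plus (mult A0 (S' s)) (mult A1 (S' (s - tau)))))).
      { intros S' H'.
        refine (filterdiff_within_subset _ (fun r => s <= r <= T) S' s _ _ _
          (fs_equation _ _ _ _ _ H' s _)); [intros r Hr|..]; lra. }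
      eapply filterdiff_ext_lin.
      - exact (filterdiff_minus_fct (F := within _ _) S1 S2 _ _ (Sub _ H1) (Sub _ H2)).
      - intro h. unfold D. rewrite !bdop_mult_minus.
        refine (eq_trans (eq_sym (scal_minus_distr_l (V := bdop_ModuleSpace) h _ _)) _).
        f_equal. apply (minus_plus_plus (G := bdop_AbelianGroup)). }
    (* The delayed argument lies either in [[0, s]], where [K] is a bound, or in the history
       interval, where both solutions vanish. *)
    assert (HK' : norm (D (s - tau)) <= K).
    { destruct (Rle_lt_dec 0 (s - tau)) as [H|H]; [apply Hu; lra|].
      unfold D. rewrite (fs_history _ _ _ _ _ H1), (fs_history _ _ _ _ _ H2) by lra.
      rewrite bdop_minus_zero_r, norm_bdop_zero. exact HK. }
    destruct (filterdiff_within_elim _ _ _ _ HD d Hd) as [e [He H]].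
    exists e. split; [exact He|]. intros r Hr HrT.
    specialize (H r ltac:(lra)). rewrite Rabs_pos_eq in H by lra.
    specialize (H ltac:(lra)).
    set (L := plus (mult A0 (D s)) (mult A1 (D (s - tau)))) in H.
    assert (HL : norm L <= (norm A0 + norm A1) * K).
    { eapply Rle_trans; [apply @norm_triangle|].
      generalize (Hm A0 (D s)) (Hm A1 (D (s - tau))) (Hu s ltac:(lra)). nra. }
    assert (HS := norm_scal (r - s) L). change (abs (r - s)) with (Rabs (r - s)) in HS.
    rewrite Rabs_pos_eq in HS by lra.
    assert (E : D r = plus (minus (minus (D r) (D s)) (scal (r - s) L))
                          (plus (D s) (scal (r - s) L))).
    { rewrite (plus_comm (D s)), plus_assoc.
      now rewrite !(plus_minus_l (G := bdop_AbelianGroup)). }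
    rewrite E. eapply Rle_trans; [apply @norm_triangle|].
    assert (H3 := norm_triangle (D s) (scal (r - s) L)).
    assert (HL' := Rmult_le_compat_l (r - s) _ _ ltac:(lra) HL).
    replace (K + (r - s) * ((norm A0 + norm A1) * K + d)) with
      (d * (r - s) + (K + (r - s) * ((norm A0 + norm A1) * K))) by ring.
    apply Rplus_le_compat; [exact H|]. refine (Rle_trans _ _ _ H3 _).
    apply Rplus_le_compat; [apply Hu; lra|]. exact (Rle_trans _ _ _ HS HL'). }
intros t Ht. rewrite <- (plus_minus_l (G := bdop_AbelianGroup) (S1 t) (S2 t)).
replace (minus (S1 t) (S2 t)) with (zero : bdop X); [apply plus_zero_l|].
symmetry. apply bdop_norm_eq_zero.
apply Rle_antisym; [exact (D_zero t Ht)|apply bdop_norm_pos].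
Qed.

Theorem theorem19 :
  forall (X : CompleteNormedModule C_AbsRing) (tau : R) (N : nat) (A0 A1 : bdop X),
    0 < tau ->
    minus (mult A0 A1) (mult A1 A0) <> zero ->
    (exists Sol : R -> bdop X,
        is_fundamental_solution A0 A1 tau (INR (N + 1) * tau) Sol) /\
    (forall Sol : R -> bdop X,
        is_fundamental_solution A0 A1 tau (INR (N + 1) * tau) Sol ->
        forall n : nat, (n <= N)%nat ->
        forall t : R, INR n * tau < t <= INR (n + 1) * tau ->
        exists v : nat -> bdop X,
          (forall l : nat, (l <= n)%nat ->
             is_series
               (fun i : nat =>
                  scal ((t - INR l * tau) ^ (l + i) / INR (fact (l + i)))
                       (Qop A0 A1 (l + i + 1) l))
               (v l)) /\
          Sol t = sum_n v n).
Proof.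
intros X tau N A0 A1 Htau _.
assert (Hfs := delay_sum_fundamental A0 A1 tau Htau N).
split; [eexists; exact Hfs|].
intros Sol HSol n Hn t Ht.
(* The uncut pieces serve as sums, because [t - l tau] is positive for [l <= n]. *)
exists (fun l => delay_piece A0 A1 l (t - INR l * tau)). split.
- intros l _.
  assert (H := delay_piece_series A0 A1 l (t - INR l * tau)).
  (* [is_series_incr_n] drops a positive number of terms, so [l = 0] is treated apart. *)
  destruct l as [|l].
  + apply is_series_ext with (2 := H). intro k. now rewrite Nat.add_1_r.
  + apply is_series_ext with (fun i => scal ((t - INR (S l) * tau) ^ (S l + i)
      / INR (fact (S l + i))) (Qop A0 A1 (S (S l + i)) (S l))).
    { intro i. now rewrite Nat.add_1_r. }
    apply (is_series_incr_n (fun k => scal ((t - INR (S l) * tau) ^ k / INR (fact k))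
      (Qop A0 A1 (S k) (S l))) (S l)); [lia|].
    (* The dropped terms, of index below [S l], vanish by [Qop_lt]. *)
    replace (sum_n _ _) with (zero : bdop X); [rewrite plus_zero_r; exact H|].
    symmetry. unfold sum_n.
    rewrite (sum_n_m_ext_loc _ (fun _ => zero : bdop X)).
    * apply sum_n_m_const_zero.
    * intros k Hk. rewrite Qop_lt by lia. apply bdop_scal_zero_r.
- assert (HnN : INR (n + 1) <= INR (N + 1)) by (apply le_INR; lia).
  assert (Hn0 := pos_INR n).
  (* Uniqueness replaces [Sol] by the constructed sum, and [t <= (n + 1) tau] lowers its last index
     from [N + 1] to [n]. *)
  rewrite (fundamental_solution_unique A0 A1 tau _ _ _ Htau HSol Hfs t) by nra.
  rewrite (delay_sum_stationary A0 A1 tau Htau n) by (lia || lra).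
  apply sum_n_ext_loc. intros l Hl. apply delay_piece_cut_ge.
  assert (INR l <= INR n) by (apply le_INR, Hl). nra.
Qed.
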